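(* Let $\mathbf{C}$ be one of the sequent calculi $\forall^+_1\mathrm{FL_e}$, $\forall^+_1\mathrm{FL_{ew}}$, $\forall^+_1\mathrm{FL_{ec}}$. Suppose $d$ is a derivation in $\mathbf{C}$ of a sequent $\Gamma(\bar y),\Pi(\bar z)\Rightarrow\Delta(\bar z)$, where $\bar y\cap\bar z=\emptyset$ (the free variables of formulas in $\Gamma$ lie in $\bar y$ and those of formulas in $\Pi,\Delta$ lie in $\bar z$). Then there exist a sentence $\chi$ and derivations $d_1,d_2$ in $\mathbf{C}$ with $\mathrm{md}(d_1),\mathrm{md}(d_2)\le\mathrm{md}(d)$ such that $d_1$ derives $\Gamma(\bar y)\Rightarrow\chi$ and $d_2$ derives $\Pi(\bar z),\chi\Rightarrow\Delta(\bar z)$.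
   Context: Formulas: first-order formulas built from unary predicates $P_i$ ($i\in\mathbb{N}$), variables $x,x_0,x_1,\dots$, binary connectives $\lor,\land,\cdot,\to$, constants $\mathrm{f},\mathrm{e}$, and quantifiers $\forall x,\exists x$ (only the variable $x$ is quantified), such that no variable $x_i$ occurs in the scope of a quantifier. A sentence is a formula with no free variables. A sequent $\Gamma\Rightarrow\Delta$ is a pair of finite multisets of formulas with $\Delta$ containing at most one formula. The calculus $\forall^+_1\mathrm{FL_e}$ has axioms $\varphi\Rightarrow\varphi$, $\mathrm{f}\Rightarrow$, $\Rightarrow\mathrm{e}$ and rules (premises / conclusion): from $\Gamma\Rightarrow\Delta$ infer $\Gamma,\mathrm{e}\Rightarrow\Delta$; from $\Gamma\Rightarrow$ infer $\Gamma\Rightarrow\mathrm{f}$; from $\Gamma_1\Rightarrow\varphi$ and $\Gamma_2,\psi\Rightarrow\Delta$ infer $\Gamma_1,\Gamma_2,\varphi\to\psi\Rightarrow\Delta$; from $\Gamma,\varphi\Rightarrow\psi$ infer $\Gamma\Rightarrow\varphi\to\psi$; from $\Gamma,\varphi,\psi\Rightarrow\Delta$ infer $\Gamma,\varphi\cdot\psi\Rightarrow\Delta$; from $\Gamma_1\Rightarrow\varphi$ and $\Gamma_2\Rightarrow\psi$ infer $\Gamma_1,\Gamma_2\Rightarrow\varphi\cdot\psi$; from $\Gamma,\varphi\Rightarrow\Delta$ (resp. $\Gamma,\psi\Rightarrow\Delta$) infer $\Gamma,\varphi\land\psi\Rightarrow\Delta$; from $\Gamma\Rightarrow\varphi$ and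 $\Gamma\Rightarrow\psi$ infer $\Gamma\Rightarrow\varphi\land\psi$; from $\Gamma,\varphi\Rightarrow\Delta$ and $\Gamma,\psi\Rightarrow\Delta$ infer $\Gamma,\varphi\lor\psi\Rightarrow\Delta$; from $\Gamma\Rightarrow\varphi$ (resp. $\Gamma\Rightarrow\psi$) infer $\Gamma\Rightarrow\varphi\lor\psi$; ($\forall\Rightarrow$) from $\Gamma,\varphi(t)\Rightarrow\Delta$ infer $\Gamma,\forall x\varphi(x)\Rightarrow\Delta$; ($\Rightarrow\forall$) from $\Gamma\Rightarrow\psi(y)$ infer $\Gamma\Rightarrow\forall x\psi(x)$; ($\exists\Rightarrow$) from $\Gamma,\varphi(y)\Rightarrow\Delta$ infer $\Gamma,\exists x\varphi(x)\Rightarrow\Delta$; ($\Rightarrow\exists$) from $\Gamma\Rightarrow\psi(t)$ infer $\Gamma\Rightarrow\exists x\psi(x)$; subject to: in ($\forall\Rightarrow$), ($\Rightarrow\exists$) the term $t$ is a variable occurring in the conclusion, and in ($\Rightarrow\forall$), ($\exists\Rightarrow$) the variable $y$ does not occur freely in the conclusion. There is no cut rule. $\forall^+_1\mathrm{FL_{ew}}$ adds weakening: from $\Gamma_1\Rightarrow\Delta_1$ infer $\Gamma_1,\Gamma_2\Rightarrow\Delta_1,\Delta_2$ (with at most one formula on the right); $\forall^+_1\mathrm{FL_{ec}}$ adds contraction: from $\Gamma_1,\Gamma_2,\Gamma_2\Rightarrow\Delta$ infer $\Gamma_1,\Gamma_2\Rightarrow\Delta$. For a derivation $d$, $\mathrm{md}(d)$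 is the maximum number of applications of the four quantifier rules ($\forall\Rightarrow$), ($\Rightarrow\forall$), ($\exists\Rightarrow$), ($\Rightarrow\exists$) on a branch of $d$. *)

(* Defs.v *)
From HB Require Import structures.
From mathcomp Require Import all_boot.
From mathcomp Require Import finmap multiset.

Set Implicit Arguments.
Unset Strict Implicit.
Unset Printing Implicit Defensive.

(* [formula V] : formulas whose freely available variables are the elements   *)
(* of V. Under a quantifier only the variable x may be used, which is         *)
(* enforced by the non-uniform parameter: the body of a quantifier lies in    *)
(* [formula unit], where [tt] stands for x. Nested quantifiers rebind x.      *)
Inductive formula (V : Type) : Type :=
| Pred of nat & V
| Fconst
| Econst
| Or   of formula V & formula V
| And  of formula V & formula V
| Prod of formula V & formula V
| Imp  of formula V & formula V
| All  of formula unit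
| Ex   of formula unit.

Arguments Fconst {V}.
Arguments Econst {V}.
Arguments All {V} _.
Arguments Ex {V} _.

(* [None] is the variable x and [Some i] is the variable x_i. *)
Definition var : Type := option nat.
Definition vx : var := None.

Fixpoint formula_encode (V : Type) (p : V -> nat) (f : formula V) :
    GenTree.tree nat :=
  match f with
  | Pred i v => GenTree.Node 0 [:: GenTree.Leaf i; GenTree.Leaf (p v)]
  | Fconst   => GenTree.Node 1 [::]
  | Econst   => GenTree.Node 2 [::]
  | Or g h   => GenTree.Node 3 [:: formula_encode p g; formula_encode p h]
  | And g h  => GenTree.Node 4 [:: formula_encode p g; formula_encode p h]
  | Prod g h => GenTree.Node 5 [:: formula_encode p g; formula_encode p h]
  | Imp g h  => GenTree.Node 6 [:: formula_encode p g; formula_encode p h]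
  | All g    => GenTree.Node 7 [:: formula_encode (fun=> 0) g]
  | Ex g     => GenTree.Node 8 [:: formula_encode (fun=> 0) g]
  end.

Fixpoint formula_decode (V : Type) (u : nat -> option V)
    (t : GenTree.tree nat) : option (formula V) :=
  let bin c a b :=
    obind (fun g => omap (c g) (formula_decode u b)) (formula_decode u a) in
  match t with
  | GenTree.Node 0 [:: GenTree.Leaf i; GenTree.Leaf n] => omap (Pred i) (u n)
  | GenTree.Node 1 [::] => Some Fconst
  | GenTree.Node 2 [::] => Some Econst
  | GenTree.Node 3 [:: a; b] => bin (@Or V) a b
  | GenTree.Node 4 [:: a; b] => bin (@And V) a b
  | GenTree.Node 5 [:: a; b] => bin (@Prod V) a b
  | GenTree.Node 6 [:: a; b] => bin (@Imp V) a b
  | GenTree.Node 7 [:: a] => omap All (formula_decode (fun=> Some tt) a)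
  | GenTree.Node 8 [:: a] => omap Ex (formula_decode (fun=> Some tt) a)
  | _ => None
  end.

Lemma formula_encodeK (V : Type) (p : V -> nat) (u : nat -> option V) :
  pcancel p u -> pcancel (formula_encode p) (formula_decode u).
Proof.
move=> pK f; elim: f p u pK => {V} //=.
- by move=> V i v p u ->.
- by move=> V g IHg h IHh p u pK; rewrite (IHg _ _ pK) /= (IHh _ _ pK).
- by move=> V g IHg h IHh p u pK; rewrite (IHg _ _ pK) /= (IHh _ _ pK).
- by move=> V g IHg h IHh p u pK; rewrite (IHg _ _ pK) /= (IHh _ _ pK).
- by move=> V g IHg h IHh p u pK; rewrite (IHg _ _ pK) /= (IHh _ _ pK).
- by move=> V g IHg p u pK; rewrite IHg //; case.
- by move=> V g IHg p u pK; rewrite IHg //; case.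
Qed.

HB.instance Definition _ (V : countType) :=
  Countable.copy (formula V)
    (pcan_type (formula_encodeK (@choice.pickleK V))).

(* [inst t phi] is phi(t): every free occurrence of x in phi becomes t. *)
Fixpoint inst (V : Type) (t : V) (f : formula unit) : formula V :=
  match f with
  | Pred i _ => Pred i t
  | Fconst   => Fconst
  | Econst   => Econst
  | Or g h   => Or (inst t g) (inst t h)
  | And g h  => And (inst t g) (inst t h)
  | Prod g h => Prod (inst t g) (inst t h)
  | Imp g h  => Imp (inst t g) (inst t h)
  | All g    => All g
  | Ex g     => Ex g
  end.

Fixpoint fv (V : Type) (f : formula V) : seq V :=
  match f with
  | Pred _ v => [:: v]
  | Fconst | Econst => [::]
  | Or g h | And g h | Prod g h | Imp g h => fv g ++ fv h
  | All _ | Ex _ => [::]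
  end.

Definition sentence (V : Type) (f : formula V) : Prop := fv f = [::].

(* Free or bound occurrence. A quantified formula contains the bound variable *)
(* x, and no other variable can occur in it.                                  *)
Fixpoint occurs (v : var) (f : formula var) : bool :=
  match f with
  | Pred _ w => v == w
  | Fconst | Econst => false
  | Or g h | And g h | Prod g h | Imp g h => occurs v g || occurs v h
  | All _ | Ex _ => v == vx
  end.

Local Open Scope mset_scope.

(* A sequent Gamma => Delta is given by [G : antecedent] and [D : succedent]; *)
(* a multiset with at most one element is represented as an option.           *)
Notation antecedent := {mset formula var}.
Notation succedent := (option (formula var)).

Definition occurs_in (v : var) (G : antecedent) (D : succedent) : bool :=
  has (occurs v) G || oapp (occurs v) false D.

Definition free_in (v : var) (G : antecedent) (D : succedent) : bool :=
  has (fun f => v \in fv f) G || oapp (fun f => v \in fv f) false D.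

Inductive calculus : Type := FLe | FLew | FLec.

(* In [wk] the multiset union D1, D2 has at most one element exactly when one *)
(* of the two is empty.                                                       *)
Inductive deriv (C : calculus) : antecedent -> succedent -> Type :=
| ax f : deriv C [mset f] (Some f)
| fL : deriv C [mset Fconst] None
| eR : deriv C mset0 (Some Econst)
| eL G D : deriv C G D -> deriv C (G `+` [mset Econst]) D
| fR G : deriv C G None -> deriv C G (Some Fconst)
| impL G1 G2 D f g :
    deriv C G1 (Some f) -> deriv C (G2 `+` [mset g]) D ->
    deriv C (G1 `+` G2 `+` [mset Imp f g]) D
| impR G f g :
    deriv C (G `+` [mset f]) (Some g) -> deriv C G (Some (Imp f g))
| prodL G D f g :
    deriv C (G `+` [mset f] `+` [mset g]) D -> deriv C (G `+` [mset Prod f g]) D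
| prodR G1 G2 f g :
    deriv C G1 (Some f) -> deriv C G2 (Some g) ->
    deriv C (G1 `+` G2) (Some (Prod f g))
| andL1 G D f g :
    deriv C (G `+` [mset f]) D -> deriv C (G `+` [mset And f g]) D
| andL2 G D f g :
    deriv C (G `+` [mset g]) D -> deriv C (G `+` [mset And f g]) D
| andR G f g :
    deriv C G (Some f) -> deriv C G (Some g) -> deriv C G (Some (And f g))
| orL G D f g :
    deriv C (G `+` [mset f]) D -> deriv C (G `+` [mset g]) D ->
    deriv C (G `+` [mset Or f g]) D
| orR1 G f g : deriv C G (Some f) -> deriv C G (Some (Or f g))
| orR2 G f g : deriv C G (Some g) -> deriv C G (Some (Or f g))
| allL G D (f : formula unit) (t : var) :
    occurs_in t (G `+` [mset All f]) D ->
    deriv C (G `+` [mset inst t f]) D -> deriv C (G `+` [mset All f]) D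
| allR G (f : formula unit) (y : var) :
    ~~ free_in y G (Some (All f)) ->
    deriv C G (Some (inst y f)) -> deriv C G (Some (All f))
| exL G D (f : formula unit) (y : var) :
    ~~ free_in y (G `+` [mset Ex f]) D ->
    deriv C (G `+` [mset inst y f]) D -> deriv C (G `+` [mset Ex f]) D
| exR G (f : formula unit) (t : var) :
    occurs_in t G (Some (Ex f)) ->
    deriv C G (Some (inst t f)) -> deriv C G (Some (Ex f))
| wk G1 G2 D1 D2 :
    C = FLew -> D1 = None \/ D2 = None ->
    deriv C G1 D1 -> deriv C (G1 `+` G2) (if D1 is Some f then Some f else D2)
| ctr G1 G2 D :
    C = FLec ->
    deriv C (G1 `+` G2 `+` G2) D -> deriv C (G1 `+` G2) D.

(* Maximal number of quantifier rule applications on a branch. *)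
Fixpoint md C G D (d : deriv C G D) : nat :=
  match d with
  | ax _ | fL | eR => 0
  | eL _ _ d1 | fR _ d1 | impR _ _ _ d1 | prodL _ _ _ _ d1
  | andL1 _ _ _ _ d1 | andL2 _ _ _ _ d1
  | orR1 _ _ _ d1 | orR2 _ _ _ d1 => md d1
  | impL _ _ _ _ _ d1 d2 | prodR _ _ _ _ d1 d2
  | andR _ _ _ d1 d2 | orL _ _ _ _ d1 d2 => maxn (md d1) (md d2)
  | allL _ _ _ _ _ d1 | allR _ _ _ _ d1
  | exL _ _ _ _ _ d1 | exR _ _ _ _ d1 => (md d1).+1
  | wk _ _ _ _ _ _ d1 | ctr _ _ _ _ d1 => md d1
  end.

(* Gamma(ys): the free variables of all formulas in Gamma belong to ys. *)
Definition fv_within (ys : seq var) (G : seq (formula var)) : Prop :=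
  forall f, f \in G -> {subset fv f <= ys}.

(* Main.v *)
(** Induction on the derivation, for every splitting of the antecedent into
    two parts G and P such that no variable is free in both G and (P, D). The
    propositional rules combine interpolants as in Maehara's method; when an
    implication in G is decomposed, the two parts change roles in its left
    premise. The side condition on the eigenvariable lets (=> All) and (Ex =>)
    keep the interpolant. So do (All =>) and (=> Ex), unless the term t already
    occurs freely on the other side. In that case the instance of the principal
    formula is moved to that side, and the quantified formula, which is a
    sentence, is absorbed into the interpolant: as [Prod chi (All f)] for
    [All f] in G, as [Imp (All f) chi] for [All f] in P, and as
    [Imp chi (Ex f)], with G and P exchanged, for (=> Ex). Absorbing it costs an axiom and
    propositional rules only, so the bound on md is preserved. *)
Require Import Defs.
From mathcomp Require Import all_boot.
From mathcomp Require Import finmap multiset.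
From mathcomp Require Import zify.

Set Implicit Arguments.
Unset Strict Implicit.
Unset Printing Implicit Defensive.

Local Open Scope mset_scope.

(** * Multiset equations and decompositions *)

Definition mset_count := (@mset0E, @msetE2, @msetnE).

Ltac mset_ac :=
  apply/msetP => ?; rewrite !mset_count; do ?case: (_ == _); lia.

Section Multisets.
Variable K : choiceType.
Implicit Types (A B G P : {mset K}) (x : K).

Lemma has_msetD (p : pred K) A B : has p (A `+` B) = has p A || has p B.
Proof.
apply/hasP/orP => [[x]|].
  by rewrite in_msetD => /orP[xA|xB] px; [left|right]; apply/hasP; exists x.
by move=> [] /hasP[x xAB px]; exists x => //; rewrite in_msetD xAB ?orbT.
Qed.

Lemma has_mset1 (p : pred K) x : has p [mset x] = p x.
Proof.
apply/hasP/idP => [[y]|px]; first by rewrite in_mset1 => /eqP ->.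
by exists x => //; rewrite in_mset1.
Qed.

(** Riesz refinement: two decompositions of one multiset have a common refinement. It distributes
    split contexts between the two parts. *)
Lemma mset_riesz A B G P :
  A `+` B = G `+` P ->
  exists A1 A2 B1 B2,
    [/\ A = A1 `+` A2, B = B1 `+` B2, G = A1 `+` B1 & P = A2 `+` B2].
Proof.
move=> /msetP E.
(* The common part of [A] and [G] is their pointwise minimum; the other three pieces are truncated
   differences. *)
exists (A `&` G), (A `\` G), (G `\` A), (P `\` (A `\` G)).
by split; apply/msetP => x; move: (E x); rewrite !mset_count; lia.
Qed.

(** Refining against a singleton puts its only element into one of the two parts; this locates the
    principal formula of a left rule. *)
Lemma mset_add1_split A x G P :
  A `+` [mset x] = G `+` P ->
  (exists2 G', G = G' `+` [mset x] & A = G' `+` P) \/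
  (exists2 P', P = P' `+` [mset x] & A = G `+` P').
Proof.
move=> /mset_riesz[A1 [A2 [B1 [B2 [-> /msetP E -> ->]]]]].
have [xB1|xB1] := ltnP 0 (B1 x).
  left; exists A1; apply/msetP => y; move: (E y) (E x) xB1; rewrite !mset_count;
    case: (eqVneq y x) => [->|_]; rewrite ?eqxx; lia.
right; exists A2; apply/msetP => y; move: (E y) (E x) xB1; rewrite !mset_count;
    case: (eqVneq y x) => [->|_]; rewrite ?eqxx; lia.
Qed.

Lemma mset1_split x G P :
  [mset x] = G `+` P ->
  (G = [mset x] /\ P = mset0) \/ (G = mset0 /\ P = [mset x]).
Proof.
rewrite -[LHS]mset0D => /mset_add1_split[] [A -> /msetP E]; [left|right];
  by split; apply/msetP => y; move: (E y); rewrite !mset_count; lia.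
Qed.

End Multisets.

(** * Free variables and occurrences *)

Lemma mem_fv_inst (V : eqType) (t v : V) (f : formula unit) :
  v \in fv (inst t f) -> v = t.
Proof.
(* A direct fixpoint: the induction principle of [formula] ranges over all parameters, whereas here
   the parameter is fixed to [unit]. *)
move: f; fix IH 1 => -[i w|||g h|g h|g h|g h|g|g] //=;
  by [rewrite inE => /eqP | rewrite mem_cat => /orP[]; apply: IH].
Qed.

Lemma occurs_fv (v : var) (f : formula var) :
  v != vx -> occurs v f = (v \in fv f).
Proof.
move=> vNx; move: f; fix IH 1 => -[i w|||g h|g h|g h|g h|g|g] /=;
  by rewrite ?inE ?mem_cat ?(IH g) ?(IH h) ?(negbTE vNx).
Qed.

Lemma occurs_in_free (v : var) G D : v != vx -> occurs_in v G D = free_in v G D.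
Proof.
move=> vNx; rewrite /occurs_in /free_in; congr (_ || _).
  by apply: eq_has => f; apply: occurs_fv.
by case: D => //= f; apply: occurs_fv.
Qed.

(** The principal formula contains x bound and has no free variable. So x always meets the side
    condition, while any other term must be free in the context. *)
Lemma occurs_in_all (t : var) G D (f : formula unit) :
  occurs_in t (G `+` [mset All f]) D = (t == vx) || free_in t G D.
Proof.
have [->|tNx] /= := eqVneq t vx; first by rewrite /occurs_in has_msetD has_mset1 orbT.
by rewrite occurs_in_free // /free_in has_msetD has_mset1 orbF.
Qed.

Lemma occurs_in_ex (t : var) G (f : formula unit) :
  occurs_in t G (Some (Ex f)) = (t == vx) || free_in t G None.
Proof.
have [->|tNx] /= := eqVneq t vx; first by rewrite /occurs_in /= orbT.
by rewrite occurs_in_free.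
Qed.

(** * Derivability with a bound on quantifier rules *)

Definition der C n G D : Prop := exists d : deriv C G D, md d <= n.

Section DerivedRules.
Variables (C : calculus) (n : nat).
Implicit Types (G : antecedent) (D : succedent) (f g : formula var).

Lemma der_leq m G D : m <= n -> der C m G D -> der C n G D.
Proof. by move=> mn [d dm]; exists d; apply: leq_trans mn. Qed.

Lemma der_ax f : der C n [mset f] (Some f).
Proof. by exists (ax C f). Qed.

Lemma der_fL : der C n [mset Fconst] None.
Proof. by exists (fL C). Qed.

Lemma der_eR : der C n mset0 (Some Econst).
Proof. by exists (eR C). Qed.

(** Here and below, an equation for the antecedent lets the rule apply up to provable equality of
    multisets. *)
Lemma der_eL G G' D : G' = G `+` [mset Econst] -> der C n G D -> der C n G' D.
Proof. by move=> -> [d dn]; exists (eL d). Qed.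

Lemma der_fR G : der C n G None -> der C n G (Some Fconst).
Proof. by move=> [d dn]; exists (fR d). Qed.

Lemma der_impL G1 G2 G D f g :
  G = G1 `+` G2 `+` [mset Imp f g] ->
  der C n G1 (Some f) -> der C n (G2 `+` [mset g]) D -> der C n G D.
Proof. by move=> -> [d dn] [e en]; exists (impL d e); rewrite /= geq_max dn. Qed.

Lemma der_impR G f g :
  der C n (G `+` [mset f]) (Some g) -> der C n G (Some (Imp f g)).
Proof. by move=> [d dn]; exists (impR d). Qed.

Lemma der_prodL G G' D f g :
  G' = G `+` [mset Prod f g] ->
  der C n (G `+` [mset f] `+` [mset g]) D -> der C n G' D.
Proof. by move=> -> [d dn]; exists (prodL d). Qed.

Lemma der_prodR G1 G2 G f g :
  G = G1 `+` G2 ->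
  der C n G1 (Some f) -> der C n G2 (Some g) -> der C n G (Some (Prod f g)).
Proof. by move=> -> [d dn] [e en]; exists (prodR d e); rewrite /= geq_max dn. Qed.

Lemma der_andL1 G G' D f g :
  G' = G `+` [mset And f g] -> der C n (G `+` [mset f]) D -> der C n G' D.
Proof. by move=> -> [d dn]; exists (andL1 g d). Qed.

Lemma der_andL2 G G' D f g :
  G' = G `+` [mset And f g] -> der C n (G `+` [mset g]) D -> der C n G' D.
Proof. by move=> -> [d dn]; exists (andL2 f d). Qed.

Lemma der_andR G f g :
  der C n G (Some f) -> der C n G (Some g) -> der C n G (Some (And f g)).
Proof. by move=> [d dn] [e en]; exists (andR d e); rewrite /= geq_max dn. Qed.

Lemma der_orL G G' D f g :
  G' = G `+` [mset Or f g] ->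
  der C n (G `+` [mset f]) D -> der C n (G `+` [mset g]) D -> der C n G' D.
Proof. by move=> -> [d dn] [e en]; exists (orL d e); rewrite /= geq_max dn. Qed.

Lemma der_orR1 G f g : der C n G (Some f) -> der C n G (Some (Or f g)).
Proof. by move=> [d dn]; exists (orR1 g d). Qed.

Lemma der_orR2 G f g : der C n G (Some g) -> der C n G (Some (Or f g)).
Proof. by move=> [d dn]; exists (orR2 f d). Qed.

Lemma der_allL G G' D (f : formula unit) (t : var) :
  G' = G `+` [mset All f] -> (t == vx) || free_in t G D ->
  der C n (G `+` [mset inst t f]) D -> der C n.+1 G' D.
Proof.
by move=> ->; rewrite -(occurs_in_all t G D f) => ot [d dn]; exists (allL ot d).
Qed.

Lemma der_allR G (f : formula unit) (y : var) :
  ~~ free_in y G None -> der C n G (Some (inst y f)) -> der C n.+1 G (Some (All f)).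
Proof. by move=> fy [d dn]; exists (@allR C G f y fy d). Qed.

Lemma der_exL G G' D (f : formula unit) (y : var) :
  G' = G `+` [mset Ex f] -> ~~ free_in y G D ->
  der C n (G `+` [mset inst y f]) D -> der C n.+1 G' D.
Proof.
move=> -> fy [d dn]; have fy' : ~~ free_in y (G `+` [mset Ex f]) D.
  by move: fy; rewrite /free_in has_msetD has_mset1 orbF.
by exists (exL fy' d).
Qed.

Lemma der_exR G (f : formula unit) (t : var) :
  (t == vx) || free_in t G None ->
  der C n G (Some (inst t f)) -> der C n.+1 G (Some (Ex f)).
Proof. by rewrite -(occurs_in_ex t G f) => ot [d dn]; exists (exR ot d). Qed.

Lemma der_wk G1 G2 G D1 D2 :
  C = FLew -> G = G1 `+` G2 -> D1 = None \/ D2 = None -> der C n G1 D1 ->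
  der C n G (if D1 is Some f then Some f else D2).
Proof. by move=> c -> D12 [d dn]; exists (wk G2 c D12 d). Qed.

Lemma der_ctr G1 G2 G D :
  C = FLec -> G = G1 `+` G2 -> der C n (G1 `+` G2 `+` G2) D -> der C n G D.
Proof. by move=> c -> [d dn]; exists (ctr c d). Qed.

Lemma der_cast G G' D : G = G' -> der C n G D -> der C n G' D.
Proof. by move=> ->. Qed.

End DerivedRules.

(** * Interpolation for separated splittings *)

Definition separated G P D := forall v, ~~ (free_in v G None && free_in v P D).

Definition interpolable C n G P D := exists chi : formula var,
  [/\ sentence chi, der C n G (Some chi) & der C n (P `+` [mset chi]) D].

Ltac free_in_bool :=
  rewrite /free_in ?has_msetD ?has_mset1 /= ?mem_cat ?in_nil;
  do ?[case: (has _ _) | case: (_ \in _) | case: (oapp _ _ _) | case: (_ == _)].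

Ltac sep_from H :=
  let v := fresh "v" in
  move=> v; move: (H v); by free_in_bool.

(** An instance brings in no free variable but [t]. [K] tells where [t] is or is not free, which
    together with separation at [t] settles the new splitting. *)
Ltac sep_inst H t f K :=
  let v := fresh "v" in
  move=> v; move: (H v) (H t) K; rewrite /free_in ?has_msetD ?has_mset1 /=;
  have [/mem_fv_inst ->|_] := boolP (v \in fv (inst t f)); by free_in_bool.

(** Separation is used instead of fixed lists of variables because terms and eigenvariables enter
    the premises. *)
Lemma interpolation C G0 D (d : deriv C G0 D) G P :
  G0 = G `+` P -> separated G P D -> interpolable C (md d) G P D.
Proof.
elim: d G P => {G0 D} /=.
- move=> f G P /mset1_split[] [-> ->] sep; [exists f|exists Econst]; split => //.
  (* Here [f] is both the left part and the succedent, so a free variable of it would violate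
     separation. *)
  + case E: (fv f) => [|v s] //; move: (sep v).
    by rewrite /free_in !has_mset1 /= E in_cons eqxx /= orbT.
  + exact: der_ax.
  + by rewrite mset0D; apply: der_ax.
  + exact: der_eR.
  + by apply: der_eL (der_ax _ _ _).
- move=> G P /mset1_split[] [-> ->] sep; [exists Fconst|exists Econst]; split => //.
  + exact: der_ax.
  + by rewrite mset0D; apply: der_fL.
  + exact: der_eR.
  + by apply: der_eL (der_fL _ _).
- move=> G P /msetP E sep; exists Econst; split=> //.
    by apply: der_cast (der_eR _ _); apply/msetP=> x;
      move: (E x); rewrite !mset_count; lia.
  by apply: der_cast (der_ax _ _ _); apply/msetP=> x;
      move: (E x); rewrite !mset_count; lia.
- move=> G0 D d IH G P /mset_add1_split[] [A -> E] sep.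
  + have [|chi [s c1 c2]] := IH _ _ E; first by sep_from sep.
    by exists chi; split=> //; apply: der_eL c1.
  + have [|chi [s c1 c2]] := IH _ _ E; first by sep_from sep.
    by exists chi; split=> //; apply: der_eL c2; mset_ac.
- move=> G0 d IH G P E sep.
  have [|chi [s c1 c2]] := IH _ _ E; first by sep_from sep.
  by exists chi; split=> //; apply: der_fR.
- move=> G1 G2 D f g d1 IH1 d2 IH2 G P.
  have [le1 le2] := (leq_maxl (md d1) (md d2), leq_maxr (md d1) (md d2)).
  move=> /mset_add1_split[] [A -> /mset_riesz[L1 [R1 [L2 [R2 [E1 E2 -> ->]]]]]] sep.
  (* The succedent [f] of the left premise has its free variables in [G], so [L1] must be the part
     that stays with it. *)
  + have [||chi1 [s1 a1 b1]] := IH1 R1 L1; [by subst; mset_ac | by sep_from sep |].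
    have [||chi2 [s2 a2 b2]] := IH2 (L2 `+` [mset g]) R2;
      [by subst; mset_ac | by sep_from sep |].
    exists (Imp chi1 chi2); split; first by rewrite /sentence /= s1 s2.
      apply: der_impR; apply: (@der_impL _ _ (L1 `+` [mset chi1]) L2 _ _ f g).
      * mset_ac.
      * exact: der_leq le1 b1.
      * exact: der_leq le2 a2.
    apply: (@der_impL _ _ R1 R2) => //; [exact: der_leq le1 a1|exact: der_leq le2 b2].
  + have [||chi1 [s1 a1 b1]] := IH1 L1 R1; [by subst; mset_ac | by sep_from sep |].
    have [||chi2 [s2 a2 b2]] := IH2 L2 (R2 `+` [mset g]);
      [by subst; mset_ac | by sep_from sep |].
    exists (Prod chi1 chi2); split; first by rewrite /sentence /= s1 s2.
      by apply: der_prodR (der_leq le1 a1) (der_leq le2 a2).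
    apply: der_prodL => //.
    apply: (@der_impL _ _ (R1 `+` [mset chi1]) (R2 `+` [mset chi2]) _ _ f g);
      [mset_ac|exact: der_leq le1 b1|].
    by apply: der_cast (der_leq le2 b2); mset_ac.
- move=> G0 f g d IH G P E sep.
  have [||chi [s a b]] := IH G (P `+` [mset f]); [by subst; mset_ac|sep_from sep|].
  exists chi; split=> //; apply: der_impR; apply: der_cast b; mset_ac.
- move=> G0 D f g d IH G P /mset_add1_split[] [A -> E] sep.
  + have [||chi [s a b]] := IH (A `+` [mset f] `+` [mset g]) P;
      [by subst; mset_ac|sep_from sep|].
    by exists chi; split=> //; apply: der_prodL a.
  + have [||chi [s a b]] := IH G (A `+` [mset f] `+` [mset g]);
      [by subst; mset_ac|sep_from sep|].
    exists chi; split=> //; apply: (@der_prodL _ _ (A `+` [mset chi]) _ _ f g);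
      [mset_ac|apply: der_cast b; mset_ac].
- move=> G1 G2 f g d1 IH1 d2 IH2 G P.
  have [le1 le2] := (leq_maxl (md d1) (md d2), leq_maxr (md d1) (md d2)).
  move=> /mset_riesz[L1 [R1 [L2 [R2 [E1 E2 -> ->]]]]] sep.
  have [||chi1 [s1 a1 b1]] := IH1 L1 R1; [by []|sep_from sep|].
  have [||chi2 [s2 a2 b2]] := IH2 L2 R2; [by []|sep_from sep|].
  exists (Prod chi1 chi2); split; first by rewrite /sentence /= s1 s2.
    by apply: der_prodR (der_leq le1 a1) (der_leq le2 a2).
  apply: der_prodL => //.
  by apply: der_prodR (der_leq le1 b1) (der_leq le2 b2); mset_ac.
- move=> G0 D f g d IH G P /mset_add1_split[] [A -> E] sep.
  + have [||chi [s a b]] := IH (A `+` [mset f]) P; [by subst; mset_ac|sep_from sep|].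
    by exists chi; split=> //; apply: der_andL1 a.
  + have [||chi [s a b]] := IH G (A `+` [mset f]); [by subst; mset_ac|sep_from sep|].
    exists chi; split=> //; apply: (@der_andL1 _ _ (A `+` [mset chi]) _ _ f g);
      [mset_ac|apply: der_cast b; mset_ac].
- move=> G0 D f g d IH G P /mset_add1_split[] [A -> E] sep.
  + have [||chi [s a b]] := IH (A `+` [mset g]) P; [by subst; mset_ac|sep_from sep|].
    by exists chi; split=> //; apply: der_andL2 a.
  + have [||chi [s a b]] := IH G (A `+` [mset g]); [by subst; mset_ac|sep_from sep|].
    exists chi; split=> //; apply: (@der_andL2 _ _ (A `+` [mset chi]) _ _ f g);
      [mset_ac|apply: der_cast b; mset_ac].
- move=> G0 f g d1 IH1 d2 IH2 G P E sep.
  have [le1 le2] := (leq_maxl (md d1) (md d2), leq_maxr (md d1) (md d2)).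
  have [||chi1 [s1 a1 b1]] := IH1 G P; [by []|sep_from sep|].
  have [||chi2 [s2 a2 b2]] := IH2 G P; [by []|sep_from sep|].
  exists (And chi1 chi2); split; first by rewrite /sentence /= s1 s2.
    by apply: der_andR; [exact: der_leq le1 a1|exact: der_leq le2 a2].
  apply: der_andR.
    by apply: der_andL1 (der_leq le1 b1).
  by apply: der_andL2 (der_leq le2 b2).
- move=> G0 D f g d1 IH1 d2 IH2 G P.
  have [le1 le2] := (leq_maxl (md d1) (md d2), leq_maxr (md d1) (md d2)).
  move=> /mset_add1_split[] [A -> E] sep.
  + have [||chi1 [s1 a1 b1]] := IH1 (A `+` [mset f]) P;
      [by subst; mset_ac|sep_from sep|].
    have [||chi2 [s2 a2 b2]] := IH2 (A `+` [mset g]) P;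
      [by subst; mset_ac|sep_from sep|].
    (* Each disjunct in [G] yields only its own interpolant, hence [Or]; when the disjunction lies
       in [P], [G] yields both, hence [And]. *)
    exists (Or chi1 chi2); split; first by rewrite /sentence /= s1 s2.
      apply: der_orL => //.
        by apply: der_orR1; exact: der_leq le1 a1.
      by apply: der_orR2; exact: der_leq le2 a2.
    by apply: der_orL (der_leq le1 b1) (der_leq le2 b2).
  + have [||chi1 [s1 a1 b1]] := IH1 G (A `+` [mset f]);
      [by subst; mset_ac|sep_from sep|].
    have [||chi2 [s2 a2 b2]] := IH2 G (A `+` [mset g]);
      [by subst; mset_ac|sep_from sep|].
    exists (And chi1 chi2); split; first by rewrite /sentence /= s1 s2.
      by apply: der_andR; [exact: der_leq le1 a1|exact: der_leq le2 a2].
    apply: (@der_orL _ _ (A `+` [mset And chi1 chi2]) _ _ f g); first by mset_ac.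
      apply: (@der_andL1 _ _ (A `+` [mset f]) _ _ chi1 chi2); first by mset_ac.
      exact: der_leq le1 b1.
    apply: (@der_andL2 _ _ (A `+` [mset g]) _ _ chi1 chi2); first by mset_ac.
    exact: der_leq le2 b2.
- move=> G0 f g d IH G P E sep.
  have [|chi [s a b]] := IH G P E; first by sep_from sep.
  by exists chi; split=> //; apply: der_orR1.
- move=> G0 f g d IH G P E sep.
  have [|chi [s a b]] := IH G P E; first by sep_from sep.
  by exists chi; split=> //; apply: der_orR2.
- move=> G0 D f t occ d IH G P; rewrite occurs_in_all in occ.
  move=> /mset_add1_split[] [A -> E] sep; subst G0.
  + have [fr|fr] := boolP (free_in t P D).
    (* The term [t] stays free in [P] or [D], so the second derivation can requantify the instance
       to [All f], which the product supplies. *)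
    * have [||chi [s a b]] := IH A (P `+` [mset inst t f]); first by mset_ac.
        sep_inst sep t f fr.
      exists (Prod chi (All f)); split; first by rewrite /sentence /= s.
        by apply: (der_prodR erefl (der_leq (leqnSn _) a)); apply: der_ax.
      apply: der_prodL => //.
      apply: (@der_allL _ _ (P `+` [mset chi]) _ _ f t) => //.
        by move: fr; rewrite /free_in has_msetD has_mset1 s; free_in_bool.
      by apply: der_cast b; mset_ac.
    (* Now [t] is x or free in [A], so the rule remains applicable after the split. *)
    * have [||chi [s a b]] := IH (A `+` [mset inst t f]) P; first by mset_ac.
        sep_inst sep t f fr.
      exists chi; split=> //; last exact: der_leq b.
      apply: der_allL a => //.
      by move: occ fr; rewrite /free_in /= s; free_in_bool.
  + have [fr|fr] := boolP (free_in t G None).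
    (* The quantifier rule moves to the first derivation; the second discharges [All f] by an
       axiom. *)
    * have [||chi [s a b]] := IH (G `+` [mset inst t f]) A; first by mset_ac.
        sep_inst sep t f fr.
      exists (Imp (All f) chi); split; first by rewrite /sentence /= s.
        apply: der_impR; apply: der_allL a => //.
        by move: fr; rewrite /free_in /= s; free_in_bool.
      apply: (@der_impL _ _ [mset All f] A _ _ (All f) chi);
        [mset_ac|exact: der_ax|exact: der_leq b].
    * have [||chi [s a b]] := IH G (A `+` [mset inst t f]); first by mset_ac.
        sep_inst sep t f fr.
      exists chi; split=> //; first exact: der_leq a.
      apply: (@der_allL _ _ (A `+` [mset chi]) _ _ f t).
      - mset_ac.
      - by move: occ fr; rewrite /free_in !has_msetD !has_mset1 s; free_in_bool.
      - by apply: der_cast b; mset_ac.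
- move=> G0 f y fr d IH G P E sep; subst G0.
  have [||chi [s a b]] := IH G P; first by [].
    sep_inst sep y f fr.
  exists chi; split=> //; first exact: der_leq a.
  apply: der_allR b.
  by move: fr; rewrite /free_in !has_msetD !has_mset1 s; free_in_bool.
- move=> G0 D f y fr d IH G P /mset_add1_split[] [A -> E] sep; subst G0.
  + have [||chi [s a b]] := IH (A `+` [mset inst y f]) P; first by mset_ac.
      sep_inst sep y f fr.
    exists chi; split=> //; last exact: der_leq b.
    apply: der_exL a => //.
    by move: fr; rewrite /free_in /= s; free_in_bool.
  + have [||chi [s a b]] := IH G (A `+` [mset inst y f]); first by mset_ac.
      sep_inst sep y f fr.
    exists chi; split=> //; first exact: der_leq a.
    apply: (@der_exL _ _ (A `+` [mset chi]) _ _ f y).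
    * mset_ac.
    * by move: fr; rewrite /free_in !has_msetD !has_mset1 s; free_in_bool.
    * by apply: der_cast b; mset_ac.
- move=> G0 f t occ d IH G P E sep; subst G0; rewrite occurs_in_ex in occ.
  have [fr|fr] := boolP (free_in t G None).
  (* As [t] is free in [G], the instance stays with [G] and [chi] is derived from [P]. *)
  + have [||chi [s a b]] := IH P G; first by mset_ac.
      sep_inst sep t f fr.
    exists (Imp chi (Ex f)); split; first by rewrite /sentence /= s.
      apply: der_impR; apply: der_exR b.
      by move: fr; rewrite /free_in !has_msetD !has_mset1 s; free_in_bool.
    apply: (@der_impL _ _ P mset0 _ _ chi (Ex f)); [mset_ac|exact: der_leq a|].
    by rewrite mset0D; apply: der_ax.
  + have [||chi [s a b]] := IH G P; first by [].
      sep_inst sep t f fr.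
    exists chi; split=> //; first exact: der_leq a.
    apply: der_exR b.
    by move: occ fr; rewrite /free_in !has_msetD !has_mset1 s; free_in_bool.
- move=> G1 G2 D1 D2 c D12 d IH G P /mset_riesz[L1 [R1 [L2 [R2 [E1 E2 -> ->]]]]] sep.
  have [||chi [s a b]] := IH L1 R1; first by [].
    by move: sep; case: (D1) => [h|] sep; sep_from sep.
  exists chi; split=> //.
    by apply: (@der_wk _ _ L1 L2 _ (Some chi) None c); [|right|].
  by apply: (@der_wk _ _ (R1 `+` [mset chi]) R2); [|mset_ac| |].
- move=> G1 G2 D c d IH G P /mset_riesz[L1 [R1 [L2 [R2 [E1 E2 -> ->]]]]] sep.
  have [||chi [s a b]] := IH (L1 `+` L2 `+` L2) (R1 `+` R2 `+` R2);
    [by rewrite E1 E2; mset_ac|sep_from sep|].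
  (* Each part contracts its own share of the duplicated multiset. *)
  exists chi; split=> //; first exact: der_ctr a.
  apply: (@der_ctr _ _ (R1 `+` [mset chi]) R2) => //; first mset_ac.
  by apply: der_cast b; mset_ac.
Qed.

Theorem theorem6p2 (C : calculus) (ys zs : seq var)
    (G P : antecedent) (D : succedent)
    (disj_yz : forall v, v \in ys -> v \notin zs)
    (hG : fv_within ys G) (hP : fv_within zs P) (hD : fv_within zs (seq_of_opt D))
    (d : deriv C (G `+` P) D) :
  exists (chi : formula var)
         (d1 : deriv C G (Some chi)) (d2 : deriv C (P `+` [mset chi]) D),
    [/\ sentence chi, (md d1 <= md d)%N & (md d2 <= md d)%N].
Proof.
have sep : separated G P D.
  (* A variable free on both sides would lie in both [ys] and [zs]. *)
  move=> v; apply/negP => /andP[]; rewrite /free_in orbF => /hasP[g gG vg].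
  have /negP vNz := disj_yz _ (hG _ gG _ vg); case/orP => [/hasP[h hh vh]|].
    exact: vNz (hP _ hh _ vh).
  case: D hD {d} => //= h hD vh; apply: vNz; apply: (hD h _ _ vh); exact: mem_head.
have [chi [s [d1 le1] [d2 le2]]] := interpolation d erefl sep.
by exists chi, d1, d2.
Qed.
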